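(* Let $k$ be a field, let $P=\mathrm{sgp}\langle x,y\mid u_i=v_i,\ i\in I\rangle$ be a semigroup presentation with $u_i,v_i\in\{x,y\}^*$, and let $\rho$ be the congruence on the free monoid $\{x,y\}^*$ generated by $\{(u_i,v_i)\mid i\in I\}$. Let $X=\{\hat x,\hat y,z,x,y\}$ be ordered by $\hat x>\hat y>z>x>y$, and let $>$ be the corresponding deg-lex order on $X^*$. Let $S_1\subset Lie(X)$ be the set consisting of the following Lie polynomials: (1) $[\hat x x],\ [\hat x y],\ [\hat y x],\ [\hat y y]$; (2) $[\hat x z]+[zx],\ [\hat y z]+[zy]$; (3') $\lfloor zu\rfloor-\lfloor zv\rfloor$ for all $(u,v)\in\rho$ with $u>v$. Then $S_1$ is a Gröbner–Shirshov basis in the free Lie algebra $Lie(X)=Lie(\hat x,\hat y,x,y,z)$ over $k$.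
   Context: Left-normed bracket: for $u=a_1a_2\cdots a_m$ with $a_j\in\{x,y\}$, $\lfloor zu\rfloor=[[\cdots[[z a_1]a_2]\cdots]a_m]$ (and $\lfloor z\rfloor=z$). Orders. Let $X$ be a well-ordered set and $X^*$ the free monoid on $X$. Lex order $\succ$: $1\succ t$ for every $t\ne 1$; and if $u=x_iu'$, $v=x_jv'$ with $x_i,x_j\in X$, then $u\succ v$ iff $x_i>x_j$, or $x_i=x_j$ and $u'\succ v'$. Deg-lex order $>$: $u>v$ iff $\deg u>\deg v$, or $\deg u=\deg v$ and $u\succ v$, where $\deg$ is word length. Free Lie algebra. $Lie(X)$ is the free Lie algebra over $k$ on $X$, regarded as the Lie subalgebra generated by $X$ in the free associative algebra $k\langle X\rangle$ with bracket $[u,v]=uv-vu$ (also written $[uv]$). For nonzero $f\in k\langle X\rangle$, $\bar f\in X^*$ is its leading (largest) word in the deg-lex order; $f$ is monic if the coefficient of $\bar f$ is $1$. Lyndon–Shirshov words. A word $w\in X^*\setminus\{1\}$ is an associative Lyndon–Shirshov word (ALSW) if $w=uv$ with $u,v\ne1$ implies $w>vu$. Each ALSW $w$ has a standard bracketing $[w]$: $[w]=w$ if $\deg w=1$, and otherwise $[w]=[[u][v]]$, where $w=uv$ and $v$ is the longest proper suffix of $w$ that is an ALSW. Special bracketing. Let $w=aub$ with $w,u$ ALSWs. Then one can write $b=cd$ (possibly $c=1$) so that $[uc]$ occurs as a bracketed subword of $[w]$ at this place, $[w]=[a[uc]d]$ (for definiteness, take $c$ of minimal length). Write $c=c_1c_2\cdots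 c_n$ with each $c_i$ an ALSW and $c_1\preceq c_2\preceq\cdots\preceq c_n$. Replacing $[uc]$ in $[w]$ by $[\cdots[[[u][c_1]][c_2]]\cdots[c_n]]$ gives the special bracketing $[w]_u$ of $w$ relative to $u$; its leading word is $w$. Normal $S$-words. Let $S\subset Lie(X)$ be a set of monic polynomials. For $s\in S$ and $a,b\in X^*$ such that $a\bar sb$ is an ALSW, $[asb]_{\bar s}$ denotes the Lie polynomial obtained from $[a\bar sb]_{\bar s}$ by replacing the bracketed subword $[\bar s]$ by $s$. More generally, an $S$-word $(asb)$ is obtained from any bracketing of the word $a\,s\,b$ in which $s\in S$ is treated as a single letter, with brackets evaluated in $Lie(X)$; it is a normal $S$-word if its leading word is $a\bar sb$. Compositions. For $f,g\in S$: (i) if $w=\bar f=a\bar gb$ for some $a,b\in X^*$, the composition of inclusion is $(f,g)_w=f-[agb]_{\bar g}$; (ii) if $w=\bar fb=a\bar g$ for some $a,b\in X^*$ with $\deg\bar f+\deg\bar g>\deg w$, the composition of intersection is $(f,g)_w=[fb]_{\bar f}-[ag]_{\bar g}$. A Lie polynomial $h$ is trivial modulo $(S,w)$ if $h=\sum_i\alpha_i(a_is_ib_i)$ (a finite sum) with $\alpha_i\in k$, each $(a_is_ib_i)$ a normal $S$-word and $a_i\bar s_ib_i<w$. The set $S$ is a Gröbner–Shirshov basis in $Lie(X)$ if every composition $(f,g)_w$ of elements $f,g\in S$ is trivial modulo $(S,w)$. *)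

(* Defs.v *)
From HB Require Import structures.
From mathcomp Require Import all_boot all_order all_algebra.
From mathcomp Require Import finmap.
From mathcomp Require Import monalg.

Set Implicit Arguments.
Unset Strict Implicit.
Unset Printing Implicit Defensive.

Import Order.TTheory GRing.Theory.
Local Open Scope ring_scope.

(* Words on X are sequences; {fmonom X} is the monoid structure on seq X, and
   {malg k[{fmonom X}]} is the free associative algebra k<X>. The definitions
   below use only that X is totally ordered; the alphabet of interest is finite. *)

Section Words.
Context (d : Order.disp_t) (X : orderType d).
Implicit Types u v w : seq X.

(* Here the empty word is the LARGEST one, unlike in Order.seqlexi. *)
Fixpoint lex_gt u v : bool :=
  match u, v with
  | _, [::] => false
  | [::], _ :: _ => true
  | x :: u', y :: v' => (y < x)%O || ((x == y) && lex_gt u' v')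
  end.

Definition lex_le u v : bool := (u == v) || lex_gt v u.

Definition deglex_gt u v : bool :=
  (size v < size u)%N || ((size u == size v) && lex_gt u v).

Definition deglex_max u v : seq X := if deglex_gt v u then v else u.

Definition ALSW w : Prop :=
  w <> [::] /\
  forall u v, w = u ++ v -> u <> [::] -> v <> [::] -> deglex_gt w (v ++ u).

End Words.

Section Bracketings.
Context (d : Order.disp_t) (X : orderType d).

(* Bracketings of nonempty words. *)
Inductive tree : Type :=
| Leaf of X
| Node of tree & tree.

Fixpoint tree_word (t : tree) : seq X :=
  match t with
  | Leaf x => [:: x]
  | Node l r => tree_word l ++ tree_word r
  end.

(* standard t: the bracketing t is the standard bracketing of its own word, so
   that [w] is the tree t with tree_word t = w and standard t. *)
Fixpoint standard (t : tree) : Prop :=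
  match t with
  | Leaf _ => True
  | Node l r =>
      [/\ ALSW (tree_word l ++ tree_word r),
          ALSW (tree_word r) /\
          (forall u v, tree_word l ++ tree_word r = u ++ v -> u <> [::] ->
             ALSW v -> (size v <= size (tree_word r))%N),
          standard l & standard r]
  end.

(* Bracketings of a word a * b in which * is one distinguished letter (the
   hole): trees with exactly one hole. *)
Inductive context : Type :=
| Hole
| InLeft of context & tree
| InRight of tree & context.

(* The word a to the left of the hole, and the word b to its right. *)
Fixpoint ctx_left (C : context) : seq X :=
  match C with
  | Hole => [::]
  | InLeft C' _ => ctx_left C'
  | InRight t C' => tree_word t ++ ctx_left C'
  end.

Fixpoint ctx_right (C : context) : seq X :=
  match C with
  | Hole => [::]
  | InLeft C' t => ctx_right C' ++ tree_word t
  | InRight _ C' => ctx_right C'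
  end.

Fixpoint plug (C : context) (t : tree) : tree :=
  match C with
  | Hole => t
  | InLeft C' t' => Node (plug C' t) t'
  | InRight t' C' => Node t' (plug C' t)
  end.

Fixpoint ctx_comp (C D : context) : context :=
  match C with
  | Hole => D
  | InLeft C' t => InLeft (ctx_comp C' D) t
  | InRight t C' => InRight t (ctx_comp C' D)
  end.

(* [...[[* t1] t2]... tn] *)
Definition spine (ts : seq tree) : context := foldl InLeft Hole ts.

(* The bracketing t has a subtree, at the place given by the context C, which is
   the standard bracketing [uc], with the words a before it and e after it. *)
Definition occurs_at (t : tree) (a u c e : seq X) (C : context) : Prop :=
  exists t', [/\ tree_word t' = u ++ c, standard t', plug C t' = t,
                 ctx_left C = a & ctx_right C = e].

(* T is the special bracketing [aub]_u with the subtree [u] replaced by a hole.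
   For ALSWs u and aub such a T exists and is unique (Shirshov). *)
Definition special_bracketing (a u b : seq X) (T : context) : Prop :=
  ALSW (a ++ u ++ b) /\ ALSW u /\
  exists (tw : tree) (c e : seq X) (C : context) (ts : seq tree),
    [/\ tree_word tw = a ++ u ++ b /\ standard tw,
        b = c ++ e /\ occurs_at tw a u c e C,
        forall c' e' C', b = c' ++ e' -> occurs_at tw a u c' e' C' ->
          (size c <= size c')%N,
        [/\ c = flatten (map tree_word ts),
            foldr and True (map standard ts) &
            sorted (@lex_le d X) (map tree_word ts)] &
        T = ctx_comp C (spine ts)].

End Bracketings.

Section FreeLie.
Context (k : fieldType) (d : Order.disp_t) (X : orderType d).

Local Notation A := {malg k[{fmonom X}]}.
Implicit Types f g h s : A.

Definition var (x : X) : A := << fmu x >>.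

Definition lie f g : A := f * g - g * f.

Inductive in_Lie : A -> Prop :=
| in_Lie_var x : in_Lie (var x)
| in_Lie_0 : in_Lie 0
| in_Lie_add f g : in_Lie f -> in_Lie g -> in_Lie (f + g)
| in_Lie_scale (c : k) f : in_Lie f -> in_Lie (c *: f)
| in_Lie_lie f g : in_Lie f -> in_Lie g -> in_Lie (lie f g).

(* The empty word is the least element of the deg-lex order, hence neutral for
   deglex_max. Meaningful for f != 0 only; lead 0 is the empty word. *)
Definition lead f : seq X :=
  \big[@deglex_max d X/[::]]_(m <- msupp f) (m : seq X).

Definition monic f : Prop := f@_(FMonom (lead f)) = 1.

Definition left_normed f (w : seq X) : A := foldl lie f (map var w).

Fixpoint tree_eval (t : tree X) : A :=
  match t with
  | Leaf x => var x
  | Node l r => lie (tree_eval l) (tree_eval r)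
  end.

Fixpoint ctx_eval (C : context X) s : A :=
  match C with
  | Hole => s
  | InLeft C' t => lie (ctx_eval C' s) (tree_eval t)
  | InRight t C' => lie (tree_eval t) (ctx_eval C' s)
  end.

(* a sbar b, the word that leads the S-word (asb) when the latter is normal *)
Definition ctx_word (C : context X) s : seq X :=
  ctx_left C ++ lead s ++ ctx_right C.

Definition normal_S_word (S : A -> Prop) (C : context X) s : Prop :=
  [/\ S s, ctx_eval C s != 0 & lead (ctx_eval C s) = ctx_word C s].

Definition trivial_mod (S : A -> Prop) (w : seq X) h : Prop :=
  exists (n : nat) (alpha : 'I_n -> k) (C : 'I_n -> context X) (s : 'I_n -> A),
    (forall i, normal_S_word S (C i) (s i) /\ deglex_gt w (ctx_word (C i) (s i)))
    /\ h = \sum_(i < n) alpha i *: ctx_eval (C i) (s i).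

(* h = f - [agb]_gbar *)
Definition inclusion_composition f g (w : seq X) h : Prop :=
  exists (a b : seq X) (T : context X),
    [/\ w = lead f, w = a ++ lead g ++ b,
        special_bracketing a (lead g) b T & h = f - ctx_eval T g].

(* h = [fb]_fbar - [ag]_gbar *)
Definition intersection_composition f g (w : seq X) h : Prop :=
  exists (a b : seq X) (T U : context X),
    [/\ w = lead f ++ b /\ w = a ++ lead g,
        (size w < size (lead f) + size (lead g))%N,
        special_bracketing [::] (lead f) b T,
        special_bracketing a (lead g) [::] U &
        h = ctx_eval T f - ctx_eval U g].

Definition GS_basis (S : A -> Prop) : Prop :=
  (forall s, S s -> in_Lie s /\ monic s) /\
  (forall f g w h, S f -> S g ->
     inclusion_composition f g w h \/ intersection_composition f g w h ->
     trivial_mod S w h).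

End FreeLie.

Inductive gen : Type := gen_x | gen_y.

Inductive congruence (I : Type) (u v : I -> seq gen) :
  seq gen -> seq gen -> Prop :=
| congr_base i : congruence u v (u i) (v i)
| congr_refl p : congruence u v p p
| congr_sym p q : congruence u v p q -> congruence u v q p
| congr_trans p q r :
    congruence u v p q -> congruence u v q r -> congruence u v p r
| congr_mul p q p' q' :
    congruence u v p q -> congruence u v p' q' ->
    congruence u v (p ++ p') (q ++ q').

(* L_hat gen_x and L_hat gen_y are the hatted letters; the letters x and y of the
   alphabet are L_gen gen_x and L_gen gen_y. *)
Inductive letter : Type := L_hat of gen | L_z | L_gen of gen.

Definition letter_rank (l : letter) : nat :=
  match l with
  | L_hat gen_x => 4
  | L_hat gen_y => 3
  | L_z => 2
  | L_gen gen_x => 1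
  | L_gen gen_y => 0
  end.

Definition letter_unrank (n : nat) : option letter :=
  match n with
  | 4 => Some (L_hat gen_x)
  | 3 => Some (L_hat gen_y)
  | 2 => Some L_z
  | 1 => Some (L_gen gen_x)
  | 0 => Some (L_gen gen_y)
  | _ => None
  end.

Lemma letter_rankK : pcancel letter_rank letter_unrank.
Proof. by case=> [[]||[]]. Qed.

HB.instance Definition _ := Countable.copy letter (pcan_type letter_rankK).

Definition letter_le (l m : letter) : bool := (letter_rank l <= letter_rank m)%N.

Lemma letter_le_anti : antisymmetric letter_le.
Proof. by move=> l m /anti_leq /(pcan_inj letter_rankK). Qed.

Lemma letter_le_trans : transitive letter_le.
Proof. by move=> m l n; apply: leq_trans. Qed.

Lemma letter_le_total : total letter_le.
Proof. by move=> l m; apply: leq_total. Qed.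

HB.instance Definition _ :=
  Order.Le_isPOrder.Build (Order.Disp tt tt) letter
    (fun l => leqnn (letter_rank l)) letter_le_anti letter_le_trans.
HB.instance Definition _ :=
  Order.POrder_isTotal.Build (Order.Disp tt tt) letter letter_le_total.

Section S1.
Context (k : fieldType) (I : Type) (u v : I -> seq gen).

Local Notation V := (var k).

Definition emb (p : seq gen) : seq letter := map L_gen p.

Inductive S1 : {malg k[{fmonom letter}]} -> Prop :=
| S1_hat (g h : gen) : S1 (lie (V (L_hat g)) (V (L_gen h)))
| S1_hat_z (g : gen) :
    S1 (lie (V (L_hat g)) (V L_z) + lie (V L_z) (V (L_gen g)))
| S1_rel (p q : seq gen) :
    congruence u v p q -> deglex_gt (emb p) (emb q) ->
    S1 (left_normed (V L_z) (emb p) - left_normed (V L_z) (emb q)).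

End S1.

Arguments S1 k {I} u v.

(* Main.v *)
Require Import Defs.
From mathcomp Require Import all_boot all_order all_algebra.
From mathcomp Require Import finmap monalg.

Set Implicit Arguments.
Unset Strict Implicit.
Unset Printing Implicit Defensive.

Import Order.TTheory GRing.Theory.
Local Open Scope ring_scope.

(* Write |_f w_| for the left-normed bracket. A special bracketing of a word
   [lead s ++ b] relative to [lead s] brackets [s] successively with standard
   bracketings t1, ..., tm of consecutive factors of [b]. By the Jacobi identity,
   bracketing with ti is the right adjoint action of the polynomial ti, whose
   leading word is its own word; so the S-word is |_s b_| plus a combination of
   |_s b'_| with [b'] smaller rearrangements of [b]. The compositions of the
   relations (3') hence reduce to differences |_zp_| - |_zq_| with [p] and [q]
   congruent. The only other overlap is [hat g] z p; there the derivation
   [hat g, -] is moved through |_zp_| by the Leibniz rule, the brackets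
   [hat g, a] it creates are relations (1), and |_z g p_| - |_z g q_| remains. *)

(** * The lexicographic and deg-lex orders on words *)

Section Words.
Context (d : Order.disp_t) (X : orderType d).
Implicit Types u v w s t : seq X.

Lemma lex_gt_irr u : lex_gt u u = false.
Proof. by elim: u => //= x u ->; rewrite ltxx andbF. Qed.

Lemma lex_gt_trans v u w : lex_gt u v -> lex_gt v w -> lex_gt u w.
Proof.
elim: u v w => [|x u IH] [|y v] [|z w] //=.
case/orP=> [yx|/andP[/eqP-> uv]] /orP[zy|/andP[/eqP<- vw]].
- by rewrite (lt_trans zy yx).
- by rewrite yx.
- by rewrite zy.
- by rewrite eqxx (IH _ _ uv vw) orbT.
Qed.

Lemma lex_gt_total u v : u != v -> lex_gt u v || lex_gt v u.
Proof.
elim: u v => [|x u IH] [|y v] //=; rewrite eqseq_cons.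
by case: (ltgtP x y) => //= _; apply: IH.
Qed.

Lemma lex_gt_catl w u v : lex_gt (w ++ u) (w ++ v) = lex_gt u v.
Proof. by elim: w => //= x w ->; rewrite eqxx ltxx. Qed.

Lemma lex_gt_catr u v s t :
  size u = size v -> lex_gt u v -> lex_gt (u ++ s) (v ++ t).
Proof.
elim: u v => [|x u IH] [|y v] //= [suv] /orP[->//|/andP[-> uv]].
by rewrite IH ?orbT.
Qed.

Lemma deglex_gt_irr u : deglex_gt u u = false.
Proof. by rewrite /deglex_gt ltnn lex_gt_irr andbF. Qed.

Lemma deglex_gt_trans v u w : deglex_gt u v -> deglex_gt v w -> deglex_gt u w.
Proof.
rewrite /deglex_gt => /orP[vu|/andP[/eqP-> uv]] /orP[wv|/andP[/eqP<- vw]].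
- by rewrite (ltn_trans wv vu).
- by rewrite vu.
- by rewrite wv.
- by rewrite eqxx (lex_gt_trans uv vw) orbT.
Qed.

Lemma deglex_gt_total u v : u != v -> deglex_gt u v || deglex_gt v u.
Proof.
move=> /lex_gt_total uv; rewrite /deglex_gt.
by case: (ltngtP (size u) (size v)).
Qed.

Lemma deglex_gt_catl w u v : deglex_gt (w ++ u) (w ++ v) = deglex_gt u v.
Proof. by rewrite /deglex_gt !size_cat ltn_add2l eqn_add2l lex_gt_catl. Qed.

Lemma deglex_gt_catr w u v : deglex_gt u v -> deglex_gt (u ++ w) (v ++ w).
Proof.
rewrite /deglex_gt !size_cat ltn_add2r eqn_add2r.
by case/orP=> [->//|/andP[/eqP e uv]]; rewrite e eqxx lex_gt_catr ?orbT.
Qed.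

(** The empty word is least, so the initial value of the fold is harmless: a running maximum of
    words at most [w] stays at most [w], and it equals [w] once [w] has been met. *)
Lemma deglex_max_big (I : eqType) (F : I -> seq X) (r : seq I) w :
  (forall i, i \in r -> (F i == w) || deglex_gt w (F i)) ->
  w \in map F r -> \big[@deglex_max d X/[::]]_(i <- r) F i = w.
Proof.
pose M (js : seq I) := \big[@deglex_max d X/[::]]_(i <- js) F i.
have nil_le s : (s == [::]) || deglex_gt s [::] by case: s.
have M_le (js : seq I) :
    (forall i, i \in js -> (F i == w) || deglex_gt w (F i)) ->
    (w == M js) || deglex_gt w (M js).
  elim: js => [|i js IH] ler; rewrite /M ?big_nil ?nil_le // big_cons -/(M js).
  rewrite /deglex_max; case: ifP => _.
    by apply: IH => j jjs; rewrite ler // inE jjs orbT.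
  by rewrite eq_sym ler // inE eqxx.
elim: r => //= i r IH ler; rewrite inE big_cons -/(M r).
have lei := ler i (mem_head _ _).
have {}ler j : j \in r -> (F j == w) || deglex_gt w (F j).
  by move=> jr; rewrite ler // inE jr orbT.
have {M_le} := M_le r ler; rewrite /deglex_max.
have [<-|Miw] := eqVneq w (F i).
  case/orP=> [/eqP<-|]; first by rewrite deglex_gt_irr.
  case: ifP => // gt1 gt2.
  by have := deglex_gt_trans gt1 gt2; rewrite deglex_gt_irr.
move=> _ /= wr; rewrite /M IH // (_ : deglex_gt _ _) //.
by move: lei; rewrite eq_sym (negPf Miw).
Qed.

End Words.

(** * Leading words of products and Lie brackets *)

Section LeadingWord.
Context (k : fieldType) (d : Order.disp_t) (X : orderType d).
Local Notation A := {malg k[{fmonom X}]}.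
Implicit Types (f g h : A) (u v w : seq X).

Definition below w f := forall m, m \in msupp f -> deglex_gt w m.

(** Monicity with leading word [w], in a form that passes through sums and products without
    computing [lead] and that excludes 0. *)
Definition leads f w := exists2 r, f = << FMonom w >> + r & below w r.

Lemma leads_lead f w : leads f w -> [/\ lead f = w, Defs.monic f & f != 0].
Proof.
case=> r -> wr.
have r0 : r@_(FMonom w) = 0.
  by apply/eqP; rewrite mcoeff_eq0; apply/negP => /wr; rewrite deglex_gt_irr.
have fw : (<< FMonom w >> + r)@_(FMonom w) = 1 :> k.
  by rewrite mcoeffD mcoeffUU r0 addr0.
have sw : FMonom w \in msupp (<< FMonom w >> + r).
  by rewrite -mcoeff_neq0 fw oner_eq0.
have lw : lead (<< FMonom w >> + r) = w.
  apply: deglex_max_big => [m /(fsubsetP (msuppD_le _ _))|].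
    rewrite inE msuppU1 inE => /orP[/eqP->|/wr ->]; by rewrite ?eqxx ?orbT.
  by apply/mapP; exists (FMonom w).
split=> //; first by rewrite /Defs.monic lw.
by apply: contraTneq sw => ->; rewrite msupp0 inE.
Qed.

Lemma belowD w f g : below w f -> below w g -> below w (f + g).
Proof.
move=> wf wg m /(fsubsetP (msuppD_le _ _)); rewrite inE => /orP[/wf|/wg] //.
Qed.

Lemma belowN w f : below w f -> below w (- f).
Proof. by move=> wf m; rewrite msuppN; apply: wf. Qed.

Lemma below_trans w v f : deglex_gt w v -> below v f -> below w f.
Proof. by move=> wv vf m /vf; apply: deglex_gt_trans. Qed.

Lemma belowU w v : deglex_gt w v -> below w << FMonom v >>.
Proof. by move=> wv m; rewrite msuppU1 inE => /eqP->. Qed.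

Lemma leads_below w v f : deglex_gt w v -> leads f v -> below w f.
Proof.
by move=> wv [r -> vr]; apply: belowD; [apply: belowU | apply: below_trans vr].
Qed.

Lemma leadsDr f g w : leads f w -> below w g -> leads (f + g) w.
Proof.
by case=> r -> wr wg; exists (r + g); rewrite ?addrA //; apply: belowD.
Qed.

Lemma monomM u v :
  (<< FMonom u >> : A) * << FMonom v >> = << FMonom (u ++ v) >>.
Proof.
rewrite malgM_def fgmulUU mulr1; congr << _ *g _ >>.
by apply: val_inj; rewrite /= fmM.
Qed.

Lemma leadsM f g u v : leads f u -> leads g v -> leads (f * g) (u ++ v).
Proof.
move=> [r -> ur] [s -> vs]; rewrite mulrDl !mulrDr monomM -addrA.
eexists; first by reflexivity.
apply: belowD; last apply: belowD.
all: move=> m /msuppM_le[m1 [m2 [m1P m2P ->]]]; rewrite fmM.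
- by move: m1P; rewrite msuppU1 inE => /eqP->; rewrite deglex_gt_catl vs.
- by move: m2P; rewrite msuppU1 inE => /eqP->; rewrite deglex_gt_catr ?ur.
(* Product of the two remainders: the factors are lowered one at a time. *)
- apply: (@deglex_gt_trans _ _ (u ++ m2)); first by rewrite deglex_gt_catl vs.
  by rewrite deglex_gt_catr ?ur.
Qed.

Lemma leads_var x : leads (var k x) [:: x].
Proof. by exists 0; rewrite ?addr0 /var ?fmuE // => m; rewrite msupp0. Qed.

Lemma leads_lie f g u v :
  leads f u -> leads g v -> deglex_gt (u ++ v) (v ++ u) ->
  leads (lie f g) (u ++ v).
Proof.
move=> fu gv uv; apply: leadsDr; first exact: leadsM.
by apply/belowN/(leads_below uv)/leadsM.
Qed.

Lemma left_normed_cat f u v :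
  left_normed f (u ++ v) = left_normed (left_normed f u) v.
Proof. by rewrite /left_normed map_cat foldl_cat. Qed.

(* The letter [x] stays the largest one, so at each step the first of the two
   products in the bracket leads. *)
Lemma leads_left_normed f x u v :
  all (fun y => (y < x)%O) v -> leads f (x :: u) ->
  leads (left_normed f v) (x :: u ++ v).
Proof.
elim: v u f => [|y v IH] u f /=; first by rewrite cats0.
case/andP=> yx vx fu; rewrite -cat_rcons; apply: IH => //.
rewrite -cats1 -cat_cons; apply: leads_lie => //; first exact: leads_var.
by rewrite /deglex_gt !size_cat addnC eqxx ltnn /= yx.
Qed.

End LeadingWord.

Lemma commutator_jacobi (R : nzRingType) (f g h : R) :
  f * (g * h - h * g) - (g * h - h * g) * f =
  ((f * g - g * f) * h - h * (f * g - g * f)) -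
  ((f * h - h * f) * g - g * (f * h - h * f)).
Proof.
rewrite !mulrBr !mulrBl !mulrA; set b := f * h * g; set c := g * h * f.
by rewrite !opprB [RHS]addrACA !subrKA [LHS]addrACA [- b - c]addrC addrACA.
Qed.

(** * Right adjoint actions of Lie polynomials and their leading terms *)

Section RightAction.
Context (k : fieldType) (d : Order.disp_t) (X : orderType d).
Local Notation A := {malg k[{fmonom X}]}.
Implicit Types (f g h : A) (u v w b c : seq X) (L M : seq (k * seq X)).

Lemma lieDl f g h : lie (f + g) h = lie f h + lie g h.
Proof. by rewrite /lie mulrDl mulrDr opprD addrACA. Qed.

Lemma lieDr f g h : lie f (g + h) = lie f g + lie f h.
Proof. by rewrite /lie mulrDl mulrDr opprD addrACA. Qed.

Lemma lieNr f g : lie f (- g) = - lie f g.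
Proof. by rewrite /lie mulNr mulrN opprB opprK addrC. Qed.

Lemma malg_scalerAr (c : k) f g : f * (c *: g) = c *: (f * g).
Proof.
apply/malgP => m; rewrite mcoeffZ.
(* The support of [c *: g] shrinks when [c] is 0, so both coefficients are summed over the supports
   of [f] and [g]. *)
rewrite (mcoeffMlw _ (fsubset_refl _) (msuppZ_le c g)) mcoeffMl.
rewrite mulr_sumr; apply: eq_bigr => u _.
rewrite mulr_sumr; apply: eq_bigr => v _.
by rewrite mcoeffZ mulrCA mulrnAr.
Qed.

Lemma lieZl (c : k) f g : lie (c *: f) g = c *: lie f g.
Proof. by rewrite /lie malg_scalerAr -scalerAl scalerBr. Qed.

(** In this form, bracketing on the right with [g, h] is the commutator of the bracketings with [g]
    and with [h]. *)
Lemma jacobi f g h : lie f (lie g h) = lie (lie f g) h - lie (lie f h) g.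
Proof. exact: commutator_jacobi. Qed.

Lemma left_normed_cons f x w :
  left_normed f (x :: w) = left_normed (lie f (var k x)) w.
Proof. by []. Qed.

Lemma left_normedD f g w :
  left_normed (f + g) w = left_normed f w + left_normed g w.
Proof.
elim: w f g => [|x w IH] f g //=.
by rewrite /left_normed /= lieDl -/(left_normed _ w) IH.
Qed.

Lemma left_normedZ (c : k) f w :
  left_normed (c *: f) w = c *: left_normed f w.
Proof.
elim: w f => [|x w IH] f //=.
by rewrite /left_normed /= lieZl -/(left_normed _ w) IH.
Qed.

Lemma left_normedN f w : left_normed (- f) w = - left_normed f w.
Proof. by rewrite -scaleN1r left_normedZ scaleN1r. Qed.

Lemma left_normed0 w : left_normed 0 w = 0 :> A.
Proof. by rewrite -(scale0r 0) left_normedZ !scale0r. Qed.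

(* [combine L] is the right adjoint action of the noncommutative polynomial
   with the list of terms L. *)
Definition combine L f := \sum_(p <- L) p.1 *: left_normed f p.2.

Definition combine_mul L M := [seq (p.1 * q.1, p.2 ++ q.2) | p <- L, q <- M].

(** The operators act on the right, so the one applied first supplies the left factor of each
    concatenation. *)
Lemma combine_comp L M f :
  combine M (combine L f) = combine (combine_mul L M) f.
Proof.
rewrite /combine /combine_mul big_allpairs_dep exchange_big /=.
apply: eq_bigr => q _.
rewrite (big_morph (fun h => left_normed h q.2)
  (fun x y => left_normedD x y q.2) (left_normed0 q.2)) scaler_sumr.
apply: eq_bigr => p _.
by rewrite left_normedZ -left_normed_cat scalerA mulrC.
Qed.

(** Rearranging preserves the length, so that [lex_gt] agrees here with deg-lex, and the letters, so
    that a rearranged word in x, y is still one. *)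
Definition lower b w := perm_eq w b && lex_gt b w.

(* [F] is the action of a multihomogeneous polynomial with leading term [b]. *)
Definition acts_as (F : A -> A) b :=
  exists2 L, {in L, forall p, lower b p.2} & F =1 combine ((1, b) :: L).

Lemma acts_as_id : acts_as id [::].
Proof.
exists [::] => // f.
by rewrite /combine big_seq1 scale1r.
Qed.

Lemma acts_as_var x : acts_as (fun f => lie f (var k x)) [:: x].
Proof.
exists [::] => // f.
by rewrite /combine big_seq1 scale1r.
Qed.

Lemma combine_mul_lower b c L M :
    {in L, forall p, lower b p.2} -> {in M, forall p, lower c p.2} ->
  exists2 N, combine_mul ((1, b) :: L) ((1, c) :: M) = (1, b ++ c) :: N
    & {in N, forall p, lower (b ++ c) p.2}.
Proof.
move=> bL cM.
(* Either [b] meets a term of [M], or a term of [L] meets any term; in the second case the left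
   factors, of equal length, already decide the comparison. *)
exists ([seq (1 * q.1, b ++ q.2) | q <- M] ++ combine_mul L ((1, c) :: M)).
  by rewrite /combine_mul /= mulr1.
move=> p; rewrite mem_cat.
case/orP=> [/mapP[q qM ->]|/allpairsPdep[q [r [qL rM ->]]]].
  have /andP[qc cq] := cM q qM.
  by rewrite /lower perm_cat2l qc lex_gt_catl cq.
have /andP[qb bq] := bL q qL.
rewrite /lower lex_gt_catr ?(perm_size qb) // perm_cat //.
by move: rM; rewrite inE => /orP[/eqP->|/cM/andP[]].
Qed.

Lemma acts_as_comp F G b c :
  acts_as F b -> acts_as G c -> acts_as (fun f => G (F f)) (b ++ c).
Proof.
move=> [L bL FE] [M cM GE]; have [N NE cN] := combine_mul_lower bL cM.
by exists N => // f; rewrite FE GE combine_comp NE.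
Qed.

(** Composed in the other order, the operators have leading word [c ++ b], a smaller rearrangement
    of [b ++ c], so the subtraction affects lower terms only. *)
Lemma acts_as_commutator F G b c :
    acts_as F b -> acts_as G c -> lex_gt (b ++ c) (c ++ b) ->
  acts_as (fun f => G (F f) - F (G f)) (b ++ c).
Proof.
move=> Fb Gc gt_bc; have [N bN GF] := acts_as_comp Fb Gc.
have [M cM FG] := acts_as_comp Gc Fb.
exists (N ++ [seq (- p.1, p.2) | p <- (1, c ++ b) :: M]).
  move=> p; rewrite mem_cat => /orP[/bN//|/mapP[q qM ->]] /=.
  move: qM; rewrite inE => /orP[/eqP->|/cM/andP[pq gt_q]] /=.
    by rewrite /lower perm_catC perm_refl gt_bc.
  rewrite /lower (lex_gt_trans gt_bc gt_q) andbT.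
  by apply: (perm_trans pq); rewrite perm_catC.
move=> f; rewrite GF FG /combine -cat_cons big_cat big_map /= -sumrN.
by congr (_ + _); apply: eq_bigr => p _; rewrite scaleNr.
Qed.

Lemma eq_acts_as F G b : F =1 G -> acts_as F b -> acts_as G b.
Proof. by move=> FG [L bL FE]; exists L => // f; rewrite -FG. Qed.

Lemma tree_word_neq0 (t : tree X) : tree_word t <> [::].
Proof. by elim: t => //= l IH r _; case: tree_word IH. Qed.

(** By [jacobi] a node acts as the commutator of its two halves; its word is an ALSW, hence exceeds
    the word with the halves exchanged. *)
Lemma acts_as_standard (t : tree X) :
  standard t -> acts_as (fun f => lie f (tree_eval k t)) (tree_word t).
Proof.
elim: t => [x _|l IHl r IHr /= [[_ lr] _ sl sr]] /=; first exact: acts_as_var.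
apply: eq_acts_as (acts_as_commutator (IHl sl) (IHr sr) _).
  by move=> f; rewrite jacobi.
have := lr _ _ erefl (tree_word_neq0 (t := l)) (tree_word_neq0 (t := r)).
by rewrite /deglex_gt !size_cat addnC ltnn eqxx.
Qed.

(** With no letter before the hole, the context only brackets on the right, each time with a subtree
    of a standard tree. *)
Lemma acts_as_context (C : context X) t :
    standard (plug C t) -> ctx_left C = [::] ->
  acts_as (ctx_eval C : A -> A) (ctx_right C).
Proof.
elim: C => [|C IH t'|t' C IH] /=; first by move=> *; apply: acts_as_id.
  case=> _ _ sC st' C0; have {IH} := IH sC C0 => aC.
  exact: acts_as_comp aC (acts_as_standard st').
by move=> _; case: tree_word (tree_word_neq0 (t := t')).
Qed.

Lemma ctx_eval_comp (C D : context X) f :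
  ctx_eval (ctx_comp C D) f = ctx_eval C (ctx_eval D f).
Proof. by elim: C => [|C IH t|t C IH] /=; [|rewrite IH|rewrite IH]. Qed.

Lemma spine_rcons (ts : seq (tree X)) t :
  spine (rcons ts t) = InLeft (spine ts) t.
Proof. by rewrite /spine foldl_rcons. Qed.

Lemma acts_as_spine (ts : seq (tree X)) :
    foldr and True (map (@standard d X) ts) ->
  acts_as (ctx_eval (spine ts) : A -> A) (flatten (map (@tree_word d X) ts)).
Proof.
elim/last_ind: ts => [_|ts t IH]; first exact: acts_as_id.
rewrite spine_rcons -!cats1 !map_cat flatten_cat foldr_cat /= cats0.
have foldr_andl P s : foldr and P s -> foldr and True s /\ P.
  by elim: s => //= Q s IHs [q /IHs[]].
case/foldr_andl=> /IH{}IH [st _].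
exact: acts_as_comp IH (acts_as_standard st).
Qed.

(** The spine acts first, by the factors of [c], and the surrounding context then acts by [e]; the
    leading words multiply to [b = c ++ e]. *)
Lemma acts_as_special_bracketing u b (T : context X) :
  special_bracketing [::] u b T -> acts_as (ctx_eval T : A -> A) b.
Proof.
case=> _ [_ [tw [c [e [C [ts [[_ sw] [-> occ] _ [-> sts _] ->]]]]]]].
have [t' [_ st' Ct C0 Ce]] := occ.
apply: (eq_acts_as (F := fun f => ctx_eval C (ctx_eval (spine ts) f))).
  by move=> f; rewrite ctx_eval_comp.
rewrite -Ce; apply: acts_as_comp (acts_as_spine sts) _.
by apply: (acts_as_context (t := t')); rewrite ?Ct.
Qed.

(** * Words around the hole and shapes of contexts *)

Lemma ctx_left_comp (C D : context X) :
  ctx_left (ctx_comp C D) = ctx_left C ++ ctx_left D.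
Proof. by elim: C => //= t C ->; rewrite catA. Qed.

Lemma ctx_right_comp (C D : context X) :
  ctx_right (ctx_comp C D) = ctx_right D ++ ctx_right C.
Proof. by elim: C => //= [|C -> t]; rewrite ?cats0 ?catA. Qed.

Lemma ctx_left_spine (ts : seq (tree X)) : ctx_left (spine ts) = [::].
Proof. by elim/last_ind: ts => // ts t IH; rewrite spine_rcons. Qed.

Lemma ctx_right_spine (ts : seq (tree X)) :
  ctx_right (spine ts) = flatten (map (@tree_word d X) ts).
Proof.
elim/last_ind: ts => // ts t IH.
by rewrite spine_rcons /= IH map_rcons flatten_rcons.
Qed.

Lemma special_bracketing_words a u b (T : context X) :
  special_bracketing a u b T -> ctx_left T = a /\ ctx_right T = b.
Proof.
case=> _ [_ [tw [c [e [C [ts [_ [-> [t' [_ _ _ Ca Ce]]] _ [-> _ _] ->]]]]]]].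
rewrite ctx_left_comp ctx_right_comp ctx_left_spine ctx_right_spine.
by rewrite Ca Ce cats0.
Qed.

(** Exhibits a left-normed bracket of [f] as a context around [f], hence as an S-word when [f] is in
    S. *)
Lemma left_normed_spine f w :
  ctx_eval (spine (map (@Leaf d X) w)) f = left_normed f w.
Proof.
elim/last_ind: w => // w x IH.
by rewrite map_rcons spine_rcons /= IH -cats1 left_normed_cat.
Qed.

Lemma tree_word_leaves w :
  flatten (map (@tree_word d X) (map (@Leaf d X) w)) = w.
Proof. by elim: w => //= x w ->. Qed.

Lemma tree_eval_plug (C : context X) t :
  tree_eval k (plug C t) = ctx_eval C (tree_eval k t).
Proof. by elim: C => [|C IH t'|t' C IH] /=; [|rewrite IH|rewrite IH]. Qed.

Lemma tree_word_plug (C : context X) t :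
  tree_word (plug C t) = ctx_left C ++ tree_word t ++ ctx_right C.
Proof. by elim: C => [|C IH t'|t' C IH] /=; rewrite ?cats0 ?IH ?catA. Qed.

Lemma ctx_Hole (C : context X) :
  ctx_left C = [::] -> ctx_right C = [::] -> C = Hole X.
Proof.
case: C => //= [C t _|t C]; last by case: tree_word (tree_word_neq0 (t := t)).
by case: (ctx_right C) (tree_word t) (tree_word_neq0 (t := t)) => [|??] [].
Qed.

Lemma special_bracketing_nil u (T : context X) :
  special_bracketing [::] u [::] T -> T = Hole X.
Proof. by case/special_bracketing_words; apply: ctx_Hole. Qed.

(** Every tree carries a letter and every node at least two, so the only letter is a leaf bracketed
    directly with the hole. *)
Lemma special_bracketing_letter x u (T : context X) :
  special_bracketing [:: x] u [::] T -> T = InRight (Leaf x) (Hole X).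
Proof.
case/special_bracketing_words; case: T => //= [T t _|t T].
  by case: (ctx_right T) (tree_word t) (tree_word_neq0 (t := t)) => [|??] [].
have size_gt0 (t' : tree X) : (0 < size (tree_word t'))%N.
  by case: tree_word (tree_word_neq0 (t := t')).
case: t => [y /= [-> T0] T0'|l r /= /(congr1 size)].
  by rewrite (ctx_Hole T0).
rewrite !size_cat /=; move: (size_gt0 l) (size_gt0 r).
by case: (size (tree_word l)) (size (tree_word r)) => [|n] [|m]; rewrite ?addnS.
Qed.

End RightAction.

(** * Linear closure of triviality and basic normal S-words *)

Section TrivialCombinations.
Context (k : fieldType) (d : Order.disp_t) (X : orderType d).
Local Notation A := {malg k[{fmonom X}]}.
Variables (S : A -> Prop) (w : seq X).
Implicit Types (f g h s : A).

Lemma trivial_mod0 : trivial_mod S w 0.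
Proof.
exists 0%N, (fun=> 0), (fun=> Hole X), (fun=> 0).
by split=> [[]|]; rewrite ?big_ord0.
Qed.

Lemma trivial_modZ (c : k) f : trivial_mod S w f -> trivial_mod S w (c *: f).
Proof.
case=> n [al [C [s [Cs ->]]]].
exists n, (fun i => c * al i), C, s; split=> //.
by rewrite scaler_sumr; apply: eq_bigr => i _; rewrite scalerA.
Qed.

Lemma trivial_modN f : trivial_mod S w f -> trivial_mod S w (- f).
Proof. by rewrite -scaleN1r; apply: trivial_modZ. Qed.

Lemma trivial_modD f g :
  trivial_mod S w f -> trivial_mod S w g -> trivial_mod S w (f + g).
Proof.
case=> n [al [C [s [Cs ->]]]] [m [be [D [t [Dt ->]]]]].
pose cat T (F : 'I_n -> T) (G : 'I_m -> T) (i : 'I_(n + m)) :=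
  match split i with inl j => F j | inr j => G j end.
exists (n + m)%N, (cat _ al be), (cat _ C D), (cat _ s t); split.
  by move=> i; rewrite /cat; case: split.
have catl T F G i : cat T F G (lshift m i) = F i.
  by rewrite /cat -[lshift m i]/(unsplit (inl i)) unsplitK.
have catr T F G i : cat T F G (rshift n i) = G i.
  by rewrite /cat -[rshift n i]/(unsplit (inr i)) unsplitK.
rewrite big_split_ord /=.
under [X in _ = X + _]eq_bigr do rewrite !catl.
by under [X in _ = _ + X]eq_bigr do rewrite !catr.
Qed.

Lemma trivial_modB f g :
  trivial_mod S w f -> trivial_mod S w g -> trivial_mod S w (f - g).
Proof. by move=> Sf Sg; apply: trivial_modD => //; apply: trivial_modN. Qed.

Lemma trivial_mod_sum (J : eqType) (r : seq J) (F : J -> A) :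
  {in r, forall j, trivial_mod S w (F j)} ->
  trivial_mod S w (\sum_(j <- r) F j).
Proof.
move=> SF; rewrite big_seq; elim/big_ind: _ => //.
  exact: trivial_mod0.
exact: trivial_modD.
Qed.

Lemma trivial_mod_S_word (C : context X) s v :
    S s -> leads s v ->
    leads (ctx_eval C s) (ctx_left C ++ v ++ ctx_right C) ->
    deglex_gt w (ctx_left C ++ v ++ ctx_right C) ->
  trivial_mod S w (ctx_eval C s).
Proof.
move=> Ss /leads_lead[sv _ _] /leads_lead[Cv _ C0] wv.
exists 1%N, (fun=> 1), (fun=> C), (fun=> s).
split; last by rewrite big_ord1 scale1r.
by rewrite /normal_S_word /ctx_word Cv sv.
Qed.

(** Serves the relations (2), whose leading words start with a hatted letter, and, with [v] empty,
    the relations (3'). *)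
Lemma trivial_mod_left_normed s x u v :
    S s -> leads s (x :: u) -> all (fun y => (y < x)%O) v ->
    deglex_gt w (x :: u ++ v) ->
  trivial_mod S w (left_normed s v).
Proof.
move=> Ss sx vx wx; rewrite -left_normed_spine.
apply: (trivial_mod_S_word Ss sx);
  rewrite ctx_left_spine ctx_right_spine tree_word_leaves //.
by rewrite left_normed_spine; apply: leads_left_normed.
Qed.

End TrivialCombinations.

(** Bookkeeping for [composition_hat]: [b] and [h] are the terms common to several of the trivial
    pieces and absent from the composition. *)
Lemma addr_regroup (M : zmodType) (a b c e f g h : M) :
  a - b + c - (e - f - (g - h)) + (h + b) = f + a + c - (e - g).
Proof.
rewrite !opprB !addrA.
(* The permutation moves b, -b, h, -h to the end, where they cancel. *)
by rewrite [LHS](ACl (6*1*3*4*7*9*2*8*5)%AC) /= !addrK.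
Qed.

(** * The relations of [S1] and their two essential compositions *)

Section Congruence.
Context (k : fieldType) (I : Type) (u v : I -> seq gen).
Local Notation V := (var k).
Local Notation S := (S1 k u v).
Implicit Types (p q b : seq gen) (a g : gen) (w : seq letter).

Definition zword p := left_normed (V L_z) (emb p).

Lemma emb_cat p q : emb (p ++ q) = emb p ++ emb q.
Proof. exact: map_cat. Qed.

Lemma zword_cat p q : left_normed (zword p) (emb q) = zword (p ++ q).
Proof. by rewrite /zword emb_cat left_normed_cat. Qed.

Lemma lt_z_hat g : (L_z < L_hat g)%O. Proof. by case: g. Qed.
Lemma lt_gen_z a : (L_gen a < L_z)%O. Proof. by case: a. Qed.

Lemma emb_lt_z p : all (fun y => (y < L_z)%O) (emb p).
Proof. by elim: p => //= - [] p ->. Qed.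

Lemma emb_lt_hat g p : all (fun y => (y < L_hat g)%O) (emb p).
Proof. by elim: p => //= - [] p ->; case: g. Qed.

(** The letters below z are exactly x and y, and having all letters below z is invariant under
    rearrangement. *)
Lemma perm_emb w p : perm_eq w (emb p) -> exists q, w = emb q.
Proof.
move=> wp; have: all (fun y => (y < L_z)%O) w.
  by rewrite (perm_all _ wp) emb_lt_z.
elim: w {wp} => [_|y w IH /= /andP[yz /IH[q ->]]]; first by exists [::].
by case: y yz => [[]||a] // _; exists (a :: q).
Qed.

Lemma emb_inj : injective emb.
Proof. by apply: inj_map => a b []. Qed.

Lemma leads_zword p : leads (zword p) (L_z :: emb p).
Proof.
exact: (leads_left_normed (u := [::]) (emb_lt_z p) (leads_var k L_z)).
Qed.

Lemma leads_rel p q :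
  deglex_gt (emb p) (emb q) -> leads (zword p - zword q) (L_z :: emb p).
Proof.
move=> pq; apply: leadsDr (leads_zword p) _.
by apply/belowN/leads_below/leads_zword; rewrite (deglex_gt_catl [:: _]).
Qed.

Lemma leads_hat g a :
  leads (lie (V (L_hat g)) (V (L_gen a))) [:: L_hat g; L_gen a].
Proof.
apply: (leads_lie (leads_var k _) (leads_var k _)).
by case: g; case: a.
Qed.

Lemma leads_hat_z g :
  leads (lie (V (L_hat g)) (V L_z) + lie (V L_z) (V (L_gen g)))
    [:: L_hat g; L_z].
Proof.
apply: leadsDr.
  by apply: (leads_lie (leads_var k _) (leads_var k _)); case: g.
apply: (@leads_below _ _ _ _ [:: L_z; L_gen g]); first by case: g.
by apply: (leads_lie (leads_var k _) (leads_var k _)); case: g.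
Qed.

(** By totality of the order the difference is zero, a relation (3') or the opposite of one, and a
    relation is by itself a normal S-word. *)
Lemma trivial_mod_rel w p q :
    congruence u v p q ->
    deglex_gt w (L_z :: emb p) -> deglex_gt w (L_z :: emb q) ->
  trivial_mod S w (zword p - zword q).
Proof.
move=> pq wp wq.
have triv p' q' : congruence u v p' q' -> deglex_gt w (L_z :: emb p') ->
    deglex_gt (emb p') (emb q') -> trivial_mod S w (zword p' - zword q').
  move=> pq' wp' gt_pq'; rewrite -[_ - _]/(left_normed _ [::]).
  have S_pq' := S1_rel k pq' gt_pq'.
  apply: trivial_mod_left_normed S_pq' (leads_rel gt_pq') _ _ => //.
  by rewrite cats0.
have [/emb_inj->|] := eqVneq (emb p) (emb q).
  by rewrite subrr; apply: trivial_mod0.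
case/deglex_gt_total/orP => gt_pq; first exact: triv.
by rewrite -opprB; apply/trivial_modN/triv => //; apply: congr_sym.
Qed.

(** The leading term of [F] turns |_zp'_| into |_zp_|, which cancels. There remain differences of
    congruent words: |_zq'b_| - |_zq_|, and |_zp'm_| - |_zq'm_| for smaller rearrangements m of
    [b]. *)
Lemma composition_rel p q p' q' b F :
    congruence u v p q -> deglex_gt (emb p) (emb q) ->
    congruence u v p' q' -> deglex_gt (emb p') (emb q') ->
    p = p' ++ b -> acts_as F (emb b) ->
  trivial_mod S (L_z :: emb p) (zword p - zword q - F (zword p' - zword q')).
Proof.
move=> pq gt_pq pq' gt_pq' Ep [L bL ->].
have congr_b c : congruence u v (p' ++ c) (q' ++ c).
  by apply: congr_mul => //; apply: congr_refl.
rewrite /combine big_cons /= scale1r left_normedD left_normedN !zword_cat -Ep.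
rewrite opprD opprB addrA addrA.
have -> : zword p - zword q + zword (q' ++ b) - zword p =
    zword (q' ++ b) - zword q.
  by rewrite [_ - _ + _]addrC [zword p - _]addrC addrA addrK.
apply: trivial_modB.
  apply: trivial_mod_rel; rewrite ?(deglex_gt_catl [:: _]) //.
    apply: congr_trans pq; rewrite Ep; exact/congr_sym/congr_b.
  by rewrite Ep !emb_cat deglex_gt_catr.
apply: trivial_mod_sum => -[c m] /bL /= /andP[mb gt_bm]; apply: trivial_modZ.
have [m' Em] := perm_emb mb; rewrite {}Em in mb gt_bm *.
have gt_m : deglex_gt (emb p) (emb (p' ++ m')).
  rewrite Ep !emb_cat deglex_gt_catl /deglex_gt (perm_size mb).
  by rewrite eqxx gt_bm orbT.
rewrite left_normedD left_normedN !zword_cat.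
apply: trivial_mod_rel; rewrite ?(deglex_gt_catl [:: _]) //.
by apply: deglex_gt_trans gt_m _; rewrite !emb_cat deglex_gt_catr.
Qed.

Lemma lie_zword p a : lie (zword p) (V (L_gen a)) = zword (p ++ [:: a]).
Proof. by rewrite -zword_cat. Qed.

Lemma zword_cons g p :
  zword (g :: p) = left_normed (lie (V L_z) (V (L_gen g))) (emb p).
Proof. by []. Qed.

(* Unification would otherwise unfold the product of {malg k[{fmonom letter}]}. *)
Local Opaque lie left_normed.

(* [hat g, a] is kept in first position: as [hat g] is larger than [z],
   [[zword p0], [hat g, a]] would not be a normal S-word. *)
Lemma trivial_mod_hat_leibniz g r p0 p :
    (size p0 + size p <= size r)%N ->
  trivial_mod S (L_hat g :: L_z :: r)
    (lie (V (L_hat g)) (left_normed (zword p0) (emb p)) -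
     left_normed (lie (V (L_hat g)) (zword p0)) (emb p)).
Proof.
elim: p p0 => [|a p IH] p0 size_r.
  by rewrite subrr; apply: trivial_mod0.
rewrite -[emb (a :: p)]/(L_gen a :: emb p).
rewrite (left_normed_cons (zword p0)) lie_zword.
rewrite (left_normed_cons (lie (V (L_hat g)) (zword p0))).
(* Leibniz rule for [hat g, -]: the first term is left to the induction, the second is a multiple of
   a relation (1). *)
have -> : lie (lie (V (L_hat g)) (zword p0)) (V (L_gen a)) =
    lie (V (L_hat g)) (zword (p0 ++ [:: a])) +
    lie (lie (V (L_hat g)) (V (L_gen a))) (zword p0).
  by rewrite -lie_zword jacobi subrK.
rewrite left_normedD opprD addrA; apply: trivial_modB.
  by apply: IH; rewrite size_cat /= addn1 addSnnS.
pose leaves (w : seq letter) := spine (map (@Leaf _ letter) w).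
have leaves_word (w : seq letter) : ctx_right (leaves w) = w.
  by rewrite ctx_right_spine tree_word_leaves.
pose t := plug (leaves (emb p0)) (Leaf L_z).
have tE : tree_eval k t = zword p0 by rewrite tree_eval_plug left_normed_spine.
have tw : tree_word t = L_z :: emb p0.
  by rewrite tree_word_plug ctx_left_spine leaves_word.
(* The relation (1) is bracketed first with |_zp0_|, then with the letters of [p]. *)
pose C := ctx_comp (leaves (emb p)) (InLeft (Hole letter) t).
rewrite -tE -[left_normed _ _]left_normed_spine.
rewrite -[X in ctx_eval _ X]/(ctx_eval (InLeft (Hole letter) t) _).
rewrite -ctx_eval_comp.
apply: (trivial_mod_S_word (S1_hat k u v g a) (leads_hat g a)).
all: rewrite ctx_left_comp ctx_right_comp ctx_left_spine leaves_word /= tw.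
  rewrite ctx_eval_comp left_normed_spine /= tE.
  apply: (leads_left_normed (x := L_hat g) (u := _ :: L_z :: emb p0)).
    exact: emb_lt_hat.
  apply: (leads_lie (leads_hat g a) (leads_zword p0)).
  by rewrite /deglex_gt !size_cat addnC eqxx ltnn /= lt_z_hat.
(* The S-word is no longer than the bound; at equal length the second letters decide, as z > a. *)
move: size_r; rewrite /deglex_gt /= !size_cat !size_map /= !ltnS addnS.
rewrite leq_eqVlt eqSS ltxx eqxx /=.
by case/orP=> [/eqP->|->//]; rewrite eqxx lt_gen_z orbT.
Qed.

(** For s the relation (2), |_sc_| = |_[hat g z]c_| + |_zgc_|. Applied to [p] and to [q], with the
    Leibniz rule, this leaves |_zgp_| - |_zgq_|, |_sq_|, the lower terms of [F] and the Leibniz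
    errors, all trivial. *)
Lemma composition_hat g p q F :
    congruence u v p q -> deglex_gt (emb p) (emb q) -> acts_as F (emb p) ->
  trivial_mod S (L_hat g :: L_z :: emb p)
    (F (lie (V (L_hat g)) (V L_z) + lie (V L_z) (V (L_gen g))) -
     lie (V (L_hat g)) (zword p - zword q)).
Proof.
move=> pq gt_pq [L pL ->].
set s := (_ + lie _ _); set W := _ :: _.
have sS := S1_hat_z k u v g.
have triv_s c :
    deglex_gt (emb p) (emb c) -> trivial_mod S W (left_normed s (emb c)).
  move=> gt_pc.
  apply: (trivial_mod_left_normed sS (leads_hat_z g) (emb_lt_hat g c)).
  by rewrite /= (deglex_gt_catl [:: _; _]).
have s_left_normed c : left_normed s (emb c) =
    left_normed (lie (V (L_hat g)) (V L_z)) (emb c) + zword (g :: c).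
  by rewrite left_normedD zword_cons.
have leibniz c := @trivial_mod_hat_leibniz g (emb p) [::] c.
have zword_nil : zword [::] = V L_z by [].
rewrite /combine big_cons /= scale1r.
set Sum := \sum_(_ <- _) _.
have triv_Sum : trivial_mod S W Sum.
  apply: trivial_mod_sum => -[c m] /pL /= /andP[mp gt_pm]; apply: trivial_modZ.
  have [m' Em] := perm_emb mp; rewrite {}Em in mp gt_pm *; apply: triv_s.
  by rewrite /deglex_gt (perm_size mp) eqxx gt_pm orbT.
have triv_p : trivial_mod S W (lie (V (L_hat g)) (zword p) -
    left_normed (lie (V (L_hat g)) (V L_z)) (emb p)).
  have := leibniz p; rewrite zword_cat zword_nil; apply.
  by rewrite size_map.
have triv_q : trivial_mod S W (lie (V (L_hat g)) (zword q) -
    left_normed (lie (V (L_hat g)) (V L_z)) (emb q)).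
  have := leibniz q; rewrite zword_cat zword_nil; apply.
  by move: gt_pq; rewrite /deglex_gt !size_map => /orP[/ltnW|/andP[/eqP->]].
have triv_gpq : trivial_mod S W (zword (g :: p) - zword (g :: q)).
  have W_rel : deglex_gt W (L_z :: emb (g :: p)).
    by rewrite /deglex_gt /= !size_map ltnn eqxx lt_z_hat.
  apply: trivial_mod_rel => //.
    by apply: (@congr_mul _ u v [:: g] [:: g]) => //; apply: congr_refl.
  by apply: deglex_gt_trans W_rel _; rewrite (deglex_gt_catl [:: _; _]).
have := trivial_modD (trivial_modB (trivial_modD triv_gpq triv_Sum)
  (trivial_modB triv_p triv_q)) (triv_s q gt_pq).
congr trivial_mod; rewrite !s_left_normed lieDr lieNr.
exact: addr_regroup.
Qed.

(** * Enumeration of the overlaps of leading words *)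

Lemma L_z_notin_emb p : L_z \notin emb p.
Proof. by apply/negP => /(allP (emb_lt_z p)); rewrite ltxx. Qed.

Lemma L_hat_notin_emb g p : L_hat g \notin emb p.
Proof. by apply/negP => /(allP (emb_lt_hat g p)); rewrite ltxx. Qed.

Lemma emb_eq_cat p p' w :
  emb p = emb p' ++ w -> exists2 b, w = emb b & p = p' ++ b.
Proof.
move=> E; have wE : w = emb (drop (size p') p).
  by rewrite /emb map_drop -/(emb p) E drop_size_cat ?size_map.
exists (drop (size p') p) => //; apply: emb_inj.
by rewrite emb_cat -wE.
Qed.

(** In a proper overlap, the first letter of the second leading word lies inside the first one; this
    excludes overlaps by letters alone. *)
Lemma mem_eq_cat (T : eqType) (x : T) (r s t t' : seq T) :
  r ++ x :: s = t ++ t' -> (size r < size t)%N -> x \in t.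
Proof.
move=> E lt_rt; have <- : nth x t (size r) = x.
  have := congr1 (fun l => nth x l (size r)) E.
  by rewrite !nth_cat ltnn subnn lt_rt /= => <-.
exact: mem_nth.
Qed.

Lemma S1_lie_monic s : S s -> in_Lie s /\ Defs.monic s.
Proof.
have var_Lie := @in_Lie_var k _ letter.
have lieN f : in_Lie f -> in_Lie (- f).
  by rewrite -scaleN1r; apply: in_Lie_scale.
have zword_Lie p : in_Lie (zword p).
  rewrite /zword; elim: (emb p) (V L_z) (var_Lie L_z) => [|x r IH] f Lf //.
  by rewrite left_normed_cons; apply/IH/in_Lie_lie.
case=> [g a|g|p q _ gt_pq]; split.
- exact: in_Lie_lie.
- by have [] := leads_lead (leads_hat g a).
- by apply: in_Lie_add; apply: in_Lie_lie.
- by have [] := leads_lead (leads_hat_z g).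
- by apply: in_Lie_add; [exact: zword_Lie | exact/lieN/zword_Lie].
- by have [] := leads_lead (leads_rel gt_pq).
Qed.

(** Indexed by the leading word, so that one case analysis yields both the relation and its
    [lead]. *)
Variant S1_spec : {malg k[{fmonom letter}]} -> seq letter -> Prop :=
| S1_spec_hat g a :
    S1_spec (lie (V (L_hat g)) (V (L_gen a))) [:: L_hat g; L_gen a]
| S1_spec_hat_z g :
    S1_spec (lie (V (L_hat g)) (V L_z) + lie (V L_z) (V (L_gen g)))
      [:: L_hat g; L_z]
| S1_spec_rel p q of congruence u v p q & deglex_gt (emb p) (emb q) :
    S1_spec (zword p - zword q) (L_z :: emb p).

Lemma S1P s : S s -> S1_spec s (lead s).
Proof.
case=> [g a|g|p q pq gt_pq].
- by have [-> _ _] := leads_lead (leads_hat g a); constructor.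
- by have [-> _ _] := leads_lead (leads_hat_z g); constructor.
- have [lead_pq _ _] := leads_lead (leads_rel gt_pq).
  by have := S1_spec_rel pq gt_pq; rewrite -{1}lead_pq; exact.
Qed.

(** Leading words of length two contain each other only when the relations coincide; hats do not
    occur in zp, and z occurs there only at the start. So only (3') inside (3') needs work. *)
Lemma inclusion_trivial (f s : {malg k[{fmonom letter}]}) w h :
  S f -> S s -> inclusion_composition f s w h -> trivial_mod S w h.
Proof.
move=> Sf Ss [a [b [T [-> E bT ->]]]].
case: (S1P Sf) (S1P Ss) E bT => [g1 a1|g1|p q pq gt_pq];
  case=> [g2 a2|g2|p' q' pq' gt_pq'] E.
- case: a E => [|x [|y [|? a]]] //= [-> -> <-].
  by move=> /special_bracketing_nil ->; rewrite subrr; apply: trivial_mod0.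
- by case: a E => [|x [|y [|? a]]].
- by case: a E => [|x [|y [|? a]]].
- by case: a E => [|x [|y [|? a]]].
- case: a E => [|x [|y [|? a]]] //= [-> <-].
  by move=> /special_bracketing_nil ->; rewrite subrr; apply: trivial_mod0.
(* Nothing is smaller than the empty word, so p' is nonempty and zp' cannot end hat g z. *)
- case: (emb p') gt_pq' E => [|? ?]; first by case: (emb q').
  by case: a => [|x [|y [|? a]]].
- have: L_hat g2 \in L_z :: emb p by rewrite E mem_cat mem_head orbT.
  by rewrite inE => /predU1P[|] //; rewrite (negPf (L_hat_notin_emb _ _)).
- have: L_hat g2 \in L_z :: emb p by rewrite E mem_cat mem_head orbT.
  by rewrite inE => /predU1P[|] //; rewrite (negPf (L_hat_notin_emb _ _)).
case: a E => [|x a] [].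
  case/emb_eq_cat=> c -> Ep /(acts_as_special_bracketing k) actT.
  exact: (composition_rel pq gt_pq pq' gt_pq' Ep actT).
move=> _ E; have: L_z \in emb p by rewrite E mem_cat mem_head orbT.
by rewrite (negPf (L_z_notin_emb _)).
Qed.

Lemma intersection_trivial (f s : {malg k[{fmonom letter}]}) w h :
  S f -> S s -> intersection_composition f s w h -> trivial_mod S w h.
Proof.
move=> Sf Ss [a [b [T [U [[-> E] lt_w bT bU ->]]]]].
have {lt_w} lt_a : (size a < size (lead f))%N.
  by move: lt_w; rewrite E size_cat ltn_add2r.
case: (S1P Sf) (S1P Ss) E lt_a bT bU => [g1 a1|g1|p q pq gt_pq];
  case=> [g2 a2|g2|p' q' pq' gt_pq'] E lt_a.
- case: a E lt_a => [|x [|y a]] //= [-> -> ->] _.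
  move=> /special_bracketing_nil -> /special_bracketing_nil ->.
  by rewrite subrr; apply: trivial_mod0.
- by case: a E lt_a => [|x [|y a]].
- by case: a E lt_a => [|x [|y a]].
- by case: a E lt_a => [|x [|y a]].
- case: a E lt_a => [|x [|y a]] //= [-> ->] _.
  move=> /special_bracketing_nil -> /special_bracketing_nil ->.
  by rewrite subrr; apply: trivial_mod0.
(* The overlap hat g z p', sharing only the letter z. *)
- case: a E lt_a => [|x [|y a]] //= [<- ->] _.
  move=> /(acts_as_special_bracketing k) actT /special_bracketing_letter ->.
  exact: (composition_hat g1 pq' gt_pq' actT).
- case: a E lt_a => [|x a] //= [_ E] lt_a.
  have: L_hat g2 \in emb p by apply: mem_eq_cat (esym E) _.
  by rewrite (negPf (L_hat_notin_emb _ _)).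
- case: a E lt_a => [|x a] //= [_ E] lt_a.
  have: L_hat g2 \in emb p by apply: mem_eq_cat (esym E) _.
  by rewrite (negPf (L_hat_notin_emb _ _)).
case: a E lt_a => [|x a] [].
  move=> Ep _ /(acts_as_special_bracketing k) actT /special_bracketing_nil ->.
  have [c Ec Ep'] := emb_eq_cat (esym Ep); rewrite {}Ec in actT *.
  (* Both words start at the same z, so this is the opposite of the difference treated for
     inclusions, with [f] and [s] exchanged. *)
  rewrite -opprB cat_cons -emb_cat -Ep'; apply: trivial_modN.
  exact: (composition_rel pq' gt_pq' pq gt_pq Ep' actT).
move=> _ E lt_a; have: L_z \in emb p by apply: mem_eq_cat (esym E) _.
by rewrite (negPf (L_z_notin_emb _)).
Qed.

End Congruence.

Theorem theorem3p1 (k : fieldType) (I : Type) (u v : I -> seq gen) :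
  GS_basis (S1 k u v).
Proof.
split=> [s|f s w h Sf Ss]; first exact: S1_lie_monic.
by case; [apply: inclusion_trivial | apply: intersection_trivial].
Qed.
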